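(* For $i=1,2$ let $\mathcal{G}_i\subset\mathbb{N}$ be a set of pairwise coprime positive integers and $\mathcal{H}_i$ a finite set of integers admissible with respect to $\mathcal{G}_i$ (i.e. $\nu_g(\mathcal{H}_i)<g$ for all $g\in\mathcal{G}_i$), and let \[ \mathcal{V}_i=\{n\in\mathbb{N}:\ n\not\equiv h \ (\mathrm{mod}\ g)\ \text{for all } h\in\mathcal{H}_i,\ g\in\mathcal{G}_i\},\qquad \mathcal{V}^2=\{(m,n)\in\mathbb{N}^2: m\in\mathcal{V}_1,\ n\in\mathcal{V}_2\}. \] Suppose the families $(\mathcal{A}^1_n)_n$ and $(\mathcal{A}^2_n)_n$ satisfy Condition A with parameters $\theta_1,\theta_2\in(0,1)$ respectively. Fix $\alpha\in(0,1)$ and let $(P_i)_{i\ge0}$ be the $\alpha$-random walk in $\mathbb{Z}^2$: $P_0=(0,0)$ and, independently at each step, $P_{i+1}=P_i+(1,0)$ with probability $\alpha$ and $P_{i+1}=P_i+(0,1)$ with probability $1-\alpha$. Let $\overline{S}_n(\mathcal{V}^2)=\frac1n\sum_{i=1}^n\mathbf{1}[P_i\in\mathcal{V}^2]$. Then almost surely \[ \lim_{n\to\infty}\overline{S}_n(\mathcal{V}^2)=c_1c_2,\qquad c_i=\prod_{g\in\mathcal{G}_i}\left(1-\frac{\nu_g(\mathcal{H}_i)}{g}\right). \]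
   Context: $\mathbb{N}$ is the set of positive integers. $\nu_g(\mathcal{H})$ is the number of distinct residue classes modulo $g$ occupied by elements of $\mathcal{H}$. $\mathcal{A}^i$ is the set consisting of $1$ and all products of distinct elements of $\mathcal{G}_i$, and $\mathcal{A}^i_n=\{a\in\mathcal{A}^i: a\le n^{A_0}\}$ for a fixed large constant $A_0$. Condition A with parameter $\theta\in(0,1]$: a family $(\mathcal{A}_x)_{x>0}$ of sets of positive integers satisfies it if (i) there is a constant $A_0>0$ with $a\ll x^{A_0}$ for all $a\in\mathcal{A}_x$, and (ii) for every $\varepsilon>0$ and $A>0$, $|\mathcal{A}_x\cap[1,y]|\ll y^{\theta}(\log y)^{-A}$ for all $y\gg x^{\varepsilon}$ (for all sufficiently large $x$). *)

(* Defs.v *)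
From HB Require Import structures.
From mathcomp Require Import all_boot all_order all_algebra finmap.
From mathcomp Require Import all_classical all_reals all_analysis.

Set Implicit Arguments.
Unset Strict Implicit.
Unset Printing Implicit Defensive.

Import Order.TTheory GRing.Theory Num.Theory.
Import numFieldNormedType.Exports.

Local Open Scope classical_set_scope.
Local Open Scope ring_scope.

Definition positive_elements (G : set nat) : Prop :=
  forall g, G g -> (0 < g)%N.

Definition pairwise_coprime (G : set nat) : Prop :=
  forall g g', G g -> G g' -> g != g' -> coprime g g'.

Definition nu (g : nat) (H : {fset int}) : nat :=
  #|` [fset (h %% g%:Z)%Z | h in H]%fset |.

Definition admissible (G : set nat) (H : {fset int}) : Prop :=
  forall g, G g -> (nu g H < g)%N.

(* The positive integers are seen inside int, so that a product of two sieved
   sets is a subset of the lattice int * int on which the walk lives. *)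
Definition sieved (G : set nat) (H : {fset int}) : set int :=
  [set n : int | 0 < n /\
    forall h g, h \in H -> G g -> ~ (n = h %[mod g%:Z])%Z].

(* The empty product gives 1. *)
Definition distinct_products (G : set nat) : set nat :=
  [set a | exists s : {fset nat},
    (forall g, g \in s -> G g) /\ a = (\prod_(g <- s) g)%N].

Definition truncated_products (R : realType) (A0 : R) (G : set nat) (x : R) :
    set nat :=
  [set a | distinct_products G a /\ a%:R <= x `^ A0].

Definition positive_integers (R : realType) : set R :=
  [set x | exists2 n : nat, (0 < n)%N & x = n%:R].
Arguments positive_integers R : clear implicits.

(* F x is the member of index x of the family; X is the set of indices, namely
   [set x | 0 < x] for a family over all positive reals, and
   positive_integers R for a sequence.  In the second clause
   y >> x ^ eps is read as y >= c * x ^ eps, for an arbitrary fixed c > 0, and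
   the bound C and the threshold x0 may depend on theta, eps, A and c but not
   on x and y. *)
Definition condition_A (R : realType) (X : set R) (F : R -> set nat)
    (theta : R) : Prop :=
  (exists B C : R, [/\ 0 < B, 0 < C &
     forall x, X x -> forall a, F x a -> a%:R <= C * x `^ B]) /\
  (forall eps A c : R, 0 < eps -> 0 < A -> 0 < c ->
     exists C x0 : R, 0 < C /\
       forall x y, X x -> x0 <= x -> c * x `^ eps <= y ->
         (#|` fset_set (F x `&` [set a | (1 <= a)%N /\ a%:R <= y])|)%:R
           <= C * (y `^ theta * ln y `^ (- A))).

(* All the factors of the admissible product lie in ]0, 1], so the partial
   products decrease, and their limit does not depend on the order in which G
   is enumerated. *)
Definition density (R : realType) (G : set nat) (H : {fset int}) : R :=
  limn (fun N : nat =>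
    \prod_(0 <= g < N | g \in G) (1 - (nu g H)%:R / g%:R) : R).

(* int * int carries the discrete sigma-algebra: an (int * int)-valued function
   is a random variable when all preimages are events. *)
Definition discrete_RV d (Omega : measurableType d) (T : Type)
    (Y : Omega -> T) : Prop :=
  forall B : set T, measurable (Y @^-1` B).

Definition mutually_independent d (Omega : measurableType d) (R : realType)
    (P : probability Omega R) (T : Type) (Y : nat -> Omega -> T) : Prop :=
  forall (J : {fset nat}) (B : nat -> set T),
    P (\bigcap_(j in [set` J]) (Y j @^-1` B j)) =
    (\prod_(j <- J) P (Y j @^-1` B j))%E.

Definition step (Omega : Type) (S : nat -> Omega -> int * int) (i : nat)
    (w : Omega) : int * int := S i.+1 w - S i w.

Definition random_walk d (Omega : measurableType d) (R : realType)
    (P : probability Omega R) (alpha : R) (S : nat -> Omega -> int * int) :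
    Prop :=
  [/\ forall w, S 0%N w = (0, 0),
      forall i, discrete_RV (S i),
      forall i, P (step S i @^-1` [set (1, 0)]) = alpha%:E,
      forall i, P (step S i @^-1` [set (0, 1)]) = (1 - alpha)%:E &
      mutually_independent P (step S)].

Definition mean_visits (R : realType) (Omega : Type)
    (S : nat -> Omega -> int * int) (V : set (int * int)) (n : nat)
    (w : Omega) : R :=
  (\sum_(1 <= i < n.+1) \1_V (S i w)) / n%:R.

(* Main.v *)
(** Condition A is only used to get [sum_(g in G) 1/g < oo].  Fix a level [z].
    Sieving by the [g < z] gives a periodic set, whose density is computed by
    the Chinese remainder theorem; the integers removed later have upper
    density at most [2 |H| sum_(g >= z) 1/g].  Both are transferred to the walk
    by a law of large numbers for bounded predictable sums
    [sum_(i < n) f_i (flip_i - alpha)], proved with second moments and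
    Borel-Cantelli along squares.  On a finite torus it makes the empirical
    measure asymptotically invariant, hence uniform.  For a set [B] of
    abscissas it compares [alpha * #{i < n : x_i in B}] with the number of
    horizontal steps leaving [B], which is at most [#(B /\ [0, n[)] since the
    abscissa never decreases.  Then [z] tends to infinity. *)

Require Import Defs.
From HB Require Import structures.
From mathcomp Require Import all_boot all_order all_algebra finmap.
From mathcomp Require Import all_classical all_reals all_analysis.
From mathcomp Require Import ring lra zify.

Import Order.TTheory GRing.Theory Num.Theory.
Import numFieldNormedType.Exports.

Local Open Scope classical_set_scope.
Local Open Scope ring_scope.

(** * Condition A and the convergence of the sum of the inverses of [G] *)

Lemma powR_exprC (R : realType) (a r : R) k : 0 <= a ->
  (a `^ r) ^+ k = (a ^+ k) `^ r.
Proof.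
by move=> a0; rewrite -powR_mulrn ?powR_ge0// -powR_mulrn// -!powRrM mulrC.
Qed.

Lemma exists_expr_ge (R : realType) (b x : R) : 1 < b ->
  exists k0, forall k, (k0 <= k)%N -> x <= b ^+ k.
Proof.
move=> b1; have b0 : 0 < b - 1 by rewrite subr_gt0.
have bern k : k%:R * (b - 1) <= b ^+ k.
  elim: k => [|k IHk]; first by rewrite mul0r.
  have : 1 <= b ^+ k by rewrite exprn_ege1// ltW.
  rewrite -natr1 exprSr; nra.
exists (Num.bound `|x / (b - 1)|) => k k0k; apply: le_trans (bern k).
rewrite -ler_pdivrMr// (le_trans (ler_norm _))//.
by rewrite (le_trans (ltW (archi_boundP (normr_ge0 _))))// ler_nat.
Qed.

(* Taking [x = 2 ^ k] and [y = x ^ A0] in Condition A, there are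
   [O (2 ^ (A0 theta k))] elements of [G] in the interval
   [2 ^ (A0 (k - 1)), 2 ^ (A0 k)]; as [theta < 1] the sum is geometric. *)
Lemma condition_A_sum_inv_bounded (R : realType) (G : set nat) (A0 theta : R) :
  positive_elements G -> 0 < A0 -> 0 < theta < 1 ->
  condition_A (positive_integers R) (truncated_products A0 G) theta ->
  exists B : R, forall N, \sum_(0 <= g < N | g \in G) g%:R^-1 <= B.
Proof.
move=> Gpos A00 /andP[th0 th1] [_ /(_ A0 1 1 A00 ltr01 ltr01)[C [x0 [C0 cA]]]].
pose b : R := 2 `^ A0.
have b1 : 1 < b.
  have := gt0_ltr_powR A00 (x := 1) (y := 2); rewrite powR1; apply; by rewrite ?nnegrE ?ltr1n.
have b0 : 0 < b by exact: lt_trans b1.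
(* At index [x = 2 ^ k] the truncation level [x ^ A0] of [truncated_products] is exactly [y k]. *)
pose y k : R := b ^+ k.
have yE k : (2 ^ k)%:R `^ A0 = y k.
  by rewrite natrX -powR_exprC.
have y1 k : 1 <= y k by rewrite exprn_ege1// ltW.
have y0 k : 0 < y k by exact: lt_le_trans (y1 k).
(* Beyond [k1] Condition A applies at [x = 2 ^ k], and [ln (y k) >= 1] makes its logarithmic factor
   at most 1. *)
have [k1 k1x0] : exists k1, forall k, (k1 <= k)%N -> x0 <= (2 ^ k)%:R /\ expR 1 <= y k.
  have [k1 k1x0] := exists_expr_ge _ 2 x0 (ltr1n _ 2).
  have [k2 k2e] := exists_expr_ge _ b (expR 1) b1.
  exists (maxn k1 k2) => k; rewrite geq_max => /andP[k1k k2k].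
  by rewrite natrX k1x0// k2e.
pose block N k := \sum_(0 <= g < N | (g \in G) && (g%:R <= y k)) (1 : R).
have countG N k : (k1 <= k)%N -> block N k <= C * b `^ theta ^+ k.
  move=> k1k; have [x0k ek] := k1x0 _ k1k.
  have Ak : (positive_integers R) (2 ^ k)%:R by exists (2 ^ k)%N; rewrite ?expn_gt0.
  have := cA _ (y k) Ak x0k _; rewrite mul1r yE => /(_ (lexx _)).
  set F := truncated_products _ _ _ `&` _ => cAk.
  have lny : 1 <= ln (y k) by rewrite -(expRK 1) ler_ln ?posrE ?expR_gt0.
  apply: (@le_trans _ _ (#|` fset_set F|%:R)); last first.
    apply: (le_trans cAk); rewrite ler_pM2l//.
    rewrite (_ : _ ^+ k = y k `^ theta); last first.
      exact/powR_exprC/ltW.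
    rewrite ler_piMr ?powR_ge0// powRN powRr1 ?(le_trans ler01)//.
    by rewrite invf_le1 ?(lt_le_trans ltr01).
  have finF : finite_set F.
    apply: (@sub_finite_set _ _ `I_(Num.truncn (y k)).+1); last exact: finite_II.
    move=> a /= [_ [_ ay]].
    by rewrite -(ltr_nat R) (le_lt_trans ay)// truncnS_gt.
  rewrite /block -big_filter big_const_seq count_predT iter_addr_0 ler_nat.
  apply: uniq_leq_size; first by rewrite filter_uniq// iota_uniq.
  move=> g; rewrite mem_filter => /andP[/andP[gG gy] _].
  rewrite in_fset_set// inE; split => /=; last first.
    by split => //; apply: Gpos; move: gG; rewrite inE.
  split; last by rewrite yE.
  (* An element of [G] is itself a product, over a singleton; hence the bound on products also
     bounds the elements of [G]. *)
  exists [fset g]%fset; rewrite big_seq_fset1; split => // g'.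
  by rewrite in_fset1 => /eqP ->; move: gG; rewrite inE.
(* Ratio of the geometric series: between [y k] and [y k.+1] there are at most
   [C * b ^ (theta * k.+1)] elements of [G], each with inverse at most [b ^ (- k)], which gives
   [C * b ^ theta * q ^ k]. *)
pose q : R := b `^ theta / b.
have q1 : q < 1.
  rewrite ltr_pdivrMr// mul1r -[ltRHS]powRr1 ?(ltW b0)// /powR gt_eqF// ltr_expR.
  by rewrite ltr_pM2r// ln_gt0.
have q0 : 0 < q by rewrite divr_gt0// powR_gt0.
have sumG N k : \sum_(0 <= g < N | (g \in G) && (g%:R <= y (k1 + k)%N)) g%:R^-1 <=
   C * b `^ theta ^+ k1 + \sum_(0 <= j < k) C * b `^ theta * q ^+ (k1 + j).
  elim: k => [|k IHk].
    rewrite (@big_geq _ _ _ 0%N 0%N)// addn0 addr0.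
    apply: (@le_trans _ _ (block N k1)); last exact: countG.
    apply: ler_sum => g /andP[gG _]; rewrite invf_le1 ?ler1n ?ltr0n;
    by apply: Gpos; move: gG; rewrite inE.
  rewrite (bigID (fun g : nat => g%:R <= y (k1 + k)%N))/= big_nat_recr//= addrA lerD//.
    apply: le_trans IHk; rewrite le_eqVlt; apply/orP; left; apply/eqP.
    apply: eq_bigl => g; rewrite -andbA; congr andb.
    apply/andb_idl => /le_trans; apply.
    by rewrite /y addnS exprS ler_peMl ?exprn_ge0 ?ltW.
  apply: (@le_trans _ _ (block N (k1 + k.+1)%N / y (k1 + k)%N)).
    rewrite /block mulr_suml; apply: le_trans (_ : \sum_(0 <= g < N |
      (g \in G) && (g%:R <= y (k1 + k.+1)%N) && ~~ (g%:R <= y (k1 + k)%N)) (1 / y (k1 + k)%N) <= _).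
      apply: ler_sum => g /andP[_]; rewrite -ltNge => /ltW yg.
      by rewrite mul1r lef_pV2 ?posrE// (lt_le_trans (y0 (k1 + k)%N)).
    rewrite [leRHS](bigID (fun g : nat => g%:R <= y (k1 + k)%N))/= lerDr.
    by rewrite sumr_ge0// => g _; rewrite mul1r invr_ge0 ltW.
  rewrite ler_pdivrMr// (le_trans (countG _ _ _))// ?leq_addr//.
  rewrite -(mulrA (C * b `^ theta)).
  have -> : q ^+ (k1 + k) * y (k1 + k)%N = b `^ theta ^+ (k1 + k).
    by rewrite /q /y expr_div_n divfK// expf_neq0 ?gt_eqF.
  by rewrite addnS exprS mulrA.
exists (C * b `^ theta ^+ k1 + C * b `^ theta / (1 - q)) => N.
have [k Nk] : exists k, N%:R <= y (k1 + k)%N.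
  have [k0 Nk0] := exists_expr_ge _ b N%:R b1.
  by exists k0; rewrite Nk0// leq_addl.
have -> : \sum_(0 <= g < N | g \in G) g%:R^-1 =
    \sum_(0 <= g < N | (g \in G) && (g%:R <= y (k1 + k)%N)) g%:R^-1 :> R.
  rewrite big_nat_cond [RHS]big_nat_cond; apply: eq_bigl => g.
  case: (ltnP g N) => //= gN; case: (g \in G) => //=.
  by rewrite (le_trans _ Nk)// ler_nat ltnW.
apply: le_trans (sumG N k) _; rewrite lerD2l -mulr_sumr ler_pM2l ?mulr_gt0 ?powR_gt0//.
rewrite -[leRHS]mul1r ler_pdivlMr ?subr_gt0//.
have -> : (\sum_(0 <= j < k) q ^+ (k1 + j)) * (1 - q) = q ^+ k1 - q ^+ (k1 + k).
  elim: k {Nk} => [|k IHk]; first by rewrite big_geq// mul0r addn0 subrr.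
  by rewrite big_nat_recr//= mulrDl IHk addnS exprSr; ring.
rewrite (@le_trans _ _ (q ^+ k1))//; first by rewrite gerBl exprn_ge0 ?ltW.
by rewrite exprn_ile1 ?ltW.
Qed.

Lemma sum_inv_tail_small (R : realType) (G : set nat) (B e : R) :
  (forall N, \sum_(0 <= g < N | g \in G) g%:R^-1 <= B) -> 0 < e ->
  exists z0, forall z N, (z0 <= z)%N ->
    \sum_(z <= g < N | g \in G) g%:R^-1 <= e.
Proof.
move=> sumB e0; pose u N : R := \sum_(0 <= g < N | g \in G) g%:R^-1.
have uS n m : (n <= m)%N -> u m = u n + \sum_(n <= g < m | g \in G) g%:R^-1.
  by move=> nm; rewrite /u -big_cat_nat.
have pos n m : 0 <= \sum_(n <= g < m | g \in G) g%:R^-1 :> R by apply: sumr_ge0.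
have /cvgrPdist_le/(_ _ e0)[z0 _ uz0] : u @ \oo --> sup (range u).
  apply: nondecreasing_cvgn; last by exists B => _ [n _ <-]; exact: sumB.
  by move=> n m nm; rewrite (uS _ _ nm) lerDl.
have u_le n : u n <= sup (range u).
  apply: sup_ubound; last by exists n.
  by exists B => _ [k _ <-]; exact: sumB.
exists z0 => z N zz0; have [zN|Nz] := leqP z N; last by rewrite big_geq ?ltW// ltnW.
have := uS _ _ zN; have := uz0 _ zz0; have := u_le N; have := u_le z.
by rewrite ler_norml => ? ? /andP[? ?] ?; lra.
Qed.

(** * Splitting the sieve at level [z], and the sparsity of what is removed above it *)

Definition sifted (G : set nat) (H : {fset int}) (z : nat) : set nat :=
  [set x | forall h g, h \in H -> G g -> (g < z)%N ->
     ~ (x%:Z = h %[mod g%:Z])%Z].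

(** The exceptional set, off which [sieved] and [sifted] agree. It contains 0 because [sieved] asks
    for positivity, whereas [sifted] does not, in order to be periodic. *)
Definition late_sieve (G : set nat) (H : {fset int}) (z : nat) : set nat :=
  [set x | x = 0%N \/ exists h g,
     [/\ h \in H, G g, (z <= g)%N & (x%:Z = h %[mod g%:Z])%Z]].

Lemma sieved_sifted (G : set nat) (H : {fset int}) z (x : nat) :
  ~ late_sieve G H z x -> sieved G H x%:Z <-> sifted G H z x.
Proof.
move=> nlate; split=> [[_ sx] h g hH Gg _|sx]; first exact: sx.
split; first by rewrite ltz_nat lt0n; apply/eqP => x0; apply: nlate; left.
move=> h g hH Gg xh; have [gz|zg] := ltnP g z; first exact: sx xh.
by apply: nlate; right; exists h, g.
Qed.

(** The first [n] integers are covered by [(n %/ g).+1] blocks of length [g], and each block meets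
    the residue class at most once. *)
Lemma count_residue_le (R : realType) (h : int) (g n : nat) : (0 < g)%N ->
  \sum_(0 <= x < n) ((x%:Z == h %[mod g%:Z])%Z%:R : R) <= n%:R / g%:R + 1.
Proof.
move=> g0; have gR : (0 : R) < g%:R by rewrite ltr0n.
pose c (x : nat) : R := (x%:Z == h %[mod g%:Z])%Z%:R.
have block k : \sum_(k * g <= x < k * g + g) c x <= 1.
  have [/existsP[r0 /eqP hr0]|none] := boolP [exists r : 'I_g, (r%:Z == h %[mod g%:Z])%Z].
    rewrite -{1}[(k * g)%N]add0n big_addn addKn big_mkord (bigD1 r0)//=.
    rewrite big1 ?addr0; first by rewrite /c; case: eqP.
    move=> r; apply: contraNeq; rewrite /c.
    have [E _|_ /negP[]//] := eqVneq ((r + k * g)%N%:Z %% g)%Z (h %% g)%Z.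
    apply/eqP/val_inj; move: E; rewrite -hr0 !modz_nat => -[].
    by rewrite addnC modnMDl !modn_small.
  rewrite big_nat big1// => x /andP[kx xk]; rewrite /c; case: eqP => // E.
  case/existsP: none; exists (Ordinal (ltn_pmod x g0)).
  by rewrite /= -modz_nat modz_mod E.
have blocks k : \sum_(0 <= x < k * g) c x <= k%:R.
  elim: k => [|k IHk]; first by rewrite mul0n big_geq.
  by rewrite mulSn addnC (@big_cat_nat _ _ _ (k * g)) ?leq_addr//= -natr1 lerD.
apply: (@le_trans _ _ (\sum_(0 <= x < (n %/ g).+1 * g) c x)).
  rewrite [leRHS](@big_cat_nat _ _ _ n)//=; last by rewrite ltnW// ltn_ceil.
  by rewrite lerDl sumr_ge0.
apply: (le_trans (blocks _)); rewrite -natr1 lerD2r ler_pdivlMr//.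
by rewrite -natrM ler_nat leq_trunc_div.
Qed.

(** A union bound over [h] and [g]. The outer 1 accounts for [x = 0] and the inner 1 for [x = h].
    Only the moduli [g < n + K] remain, where [K] exceeds every [|h|]; for them
    [n / g + 1 = (n + g) / g] is at most [(2 n + K) / g], so that the rounding errors are absorbed
    in the tail of the sum of inverses. *)
Lemma count_late_sieve_le (R : realType) (G : set nat) (H : {fset int})
    (z n : nat) (tau : R) :
  positive_elements G ->
  (forall N, \sum_(z <= g < N | g \in G) g%:R^-1 <= tau) ->
  \sum_(0 <= x < n) (\1_(late_sieve G H z) x : R) <=
  1 + (size H)%:R * (1 + (2 * n%:R + (\sum_(h <- H) `|h|%N.+1)%N%:R) * tau).
Proof.
move=> Gpos tail; set K := (\sum_(h <- H) `|h|%N.+1)%N.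
pose c (h : int) (g x : nat) : R := (x%:Z == h %[mod g%:Z])%Z%:R.
have c_ge0 h g x : 0 <= c h g x by [].
have hK h : h \in H -> (`|h|%N < K)%N.
  move=> hH; rewrite /K (big_rem h)//=; exact: leq_addr.
apply: (@le_trans _ _ (\sum_(0 <= x < n) ((x == 0)%:R + \sum_(h <- H)
    ((x%:Z == h)%:R + \sum_(z <= g < n + K | g \in G) c h g x)))).
  rewrite !big_nat; apply: ler_sum => x /= xn.
  rewrite indicE; case: (boolP (x \in _)) => [|_]; last first.
    by rewrite addr_ge0// sumr_ge0// => h _; rewrite addr_ge0// sumr_ge0.
  rewrite inE => -[->|[h [g [hH Gg zg xh]]]].
    by rewrite eqxx lerDl sumr_ge0// => h _; rewrite addr_ge0// sumr_ge0.
  apply: (@le_trans _ _ (\sum_(h <- H) ((x%:Z == h)%:R +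
      \sum_(z <= g < n + K | g \in G) c h g x))); last by rewrite lerDr.
  rewrite (big_rem h)//= ler_wpDr//.
    by apply: sumr_ge0 => h' _; rewrite addr_ge0// sumr_ge0.
  (* If [g >= n + K] then [|x - h| < g], and the congruence forces [x = h]. *)
  have [gnK|nKg] := ltnP g (n + K).
    rewrite ler_wpDl// (big_rem g)/= ?mem_index_iota ?zg//.
    by rewrite mem_set// /c xh eqxx ler_wpDr// sumr_ge0.
  rewrite ler_wpDr ?sumr_ge0//; suff -> : x%:Z = h by rewrite eqxx.
  move/eqP: xh; rewrite eqz_mod_dvd => /dvdzP[q xq].
  have {}hK := hK _ hH.
  have [q0|q0] := eqVneq q 0; first by move: xq; rewrite q0 mul0r => /subr0_eq.
  nia.
rewrite big_split/=; apply: lerD.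
  case: n => [|n]; first by rewrite big_geq.
  by rewrite big_nat_recl//= big1 ?addr0.
have n_K g : (z <= g < n + K)%N -> g \in G ->
    n%:R / g%:R + 1 <= (2 * n%:R + K%:R) * g%:R^-1 :> R.
  move=> /andP[_ gnK] gG; have g0 : (0 < g)%N by apply: Gpos; move: gG; rewrite inE.
  have -> : n%:R / g%:R + 1 = (n%:R + g%:R) * g%:R^-1 :> R.
    by rewrite mulrDl divff// pnatr_eq0 -lt0n.
  rewrite ler_pM2r ?invr_gt0 ?ltr0n// mulr_natl mulr2n -addrA lerD2l.
  by rewrite -natrD ler_nat ltnW.
have each h : \sum_(0 <= x < n) ((x%:Z == h)%:R +
    \sum_(z <= g < n + K | g \in G) c h g x) <= 1 + (2 * n%:R + K%:R) * tau.
  rewrite big_split/=; apply: lerD.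
    have [/existsP[y /eqP <-]|none] := boolP [exists y : 'I_n, y%:Z == h].
      rewrite big_mkord (bigD1 y)//= eqxx big1 ?addr0// => x.
      by rewrite -val_eqE eqz_nat /= => /negPf ->.
    rewrite big_nat big1// => x /= xn; case: eqP => // xh.
    by case/existsP: none; exists (Ordinal xn); rewrite /= xh.
  rewrite exchange_big/=; apply: le_trans (ler_wpM2l _ (tail (n + K)%N)).
    rewrite mulr_sumr big_nat_cond [leRHS]big_nat_cond; apply: ler_sum => g /andP[gnK gG].
    apply: le_trans (n_K _ gnK gG); apply: count_residue_le.
    by apply: Gpos; move: gG; rewrite inE.
  by rewrite addr_ge0// mulr_ge0.
rewrite exchange_big/=; apply: le_trans (ler_sum _ (fun h _ => each h)) _.
by rewrite big_const_seq count_predT iter_addr_0 -[leLHS]mulr_natl.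
Qed.

Lemma late_sieve_sparse (R : realType) (G : set nat) (H : {fset int}) (B e : R) :
  positive_elements G ->
  (forall N, \sum_(0 <= g < N | g \in G) g%:R^-1 <= B) -> 0 < e ->
  exists z0, forall z, (z0 <= z)%N -> \forall n \near \oo,
    \sum_(0 <= x < n) \1_(late_sieve G H z) x <= e * n%:R.
Proof.
move=> Gpos sumB e0; set s : R := (size H)%:R; set K := (\sum_(h <- H) `|h|%N.+1)%N%:R : R.
have s0 : 0 <= s by [].
(* With this choice the term [2 * s * tau * n] uses at most half of [e * n]; the terms independent
   of [n] fit in the other half for large [n]. *)
pose tau := e / (4 * (s + 1)).
have tau0 : 0 < tau by rewrite divr_gt0// mulr_gt0// ltr_wpDl.
have [z0 tail] := sum_inv_tail_small _ _ _ _ sumB tau0.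
exists z0 => z z0z; near=> n.
apply: (le_trans (count_late_sieve_le _ G H z n tau Gpos _)) => [N|].
  exact: tail.
have stau : s * tau <= e / 4.
  rewrite /tau mulrA ler_pdivrMr; last by rewrite mulr_gt0// ltr_wpDl.
  by lra.
have large : 2 * (1 + s * (1 + K * tau)) <= e * n%:R.
  rewrite mulrC -ler_pdivrMl//; near: n; exact: nbhs_infty_ger.
rewrite -/K -/s.
have : s * tau * n%:R <= e / 4 * n%:R by rewrite ler_wpM2r.
lra.
Unshelve. all: by end_near. Qed.

(** * Density of the periodic set [sifted], by the Chinese remainder theorem *)

Lemma sum_crt (R : comPzSemiRingType) (m n : nat) (f g : nat -> R) :
  (0 < m)%N -> (0 < n)%N -> coprime m n ->
  \sum_(r < m * n) f (r %% m)%N * g (r %% n)%N =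
  (\sum_(r < m) f r) * (\sum_(r < n) g r).
Proof.
move=> m0 n0 cop; rewrite big_distrlr/= pair_big/=.
(* The reduction map is injective by the Chinese remainder theorem, hence bijective by cardinality,
   and reindexes the double sum. *)
pose p (r : 'I_(m * n)) := (Ordinal (ltn_pmod r m0), Ordinal (ltn_pmod r n0)).
have p_inj : injective p.
  move=> r s [rm rn]; apply/val_inj => /=.
  have : (r == s %[mod m * n])%N by rewrite chinese_remainder// rm rn !eqxx.
  by rewrite !modn_small// => /eqP.
rewrite (reindex p)//; apply: onW_bij; apply: inj_card_bij => //.
by rewrite card_prod !card_ord.
Qed.

Lemma count_sifted_residues (R : realType) (H : {fset int}) (g : nat) :
  (0 < g)%N ->
  \sum_(r < g) \1_[set x : nat | forall h, h \in H -> ~ (x%:Z = h %[mod g%:Z])%Z] (r : nat)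
  = g%:R - (nu g H)%:R :> R.
Proof.
move=> g0; rewrite /nu; set S := [fset _ | h in H]%fset.
have mem (r : 'I_g) : (r%:Z \in S) = `[< exists2 h, h \in H & (r%:Z = h %[mod g%:Z])%Z >].
  apply/idP/asboolP => [/imfsetP[h /= hH ->]|[h hH rh]].
    by exists h; rewrite // modz_mod.
  by apply/imfsetP; exists h; rewrite //= -rh modz_small// ltz_nat ltn_ord.
transitivity (\sum_(r < g) (1 - (r%:Z \in S)%:R) : R).
  apply: eq_bigr => r _; rewrite indicE mem; case: asboolP => [[h hH rh]|none].
    by rewrite memNset ?subrr// => /(_ _ hH).
  by rewrite mem_set ?subr0// => h hH rh; apply: none; exists h.
rewrite sumrB sumr_const card_ord; congr (_ - _).
(* Double counting: every [s] in [S] is a reduced residue, hence equals exactly one [r < g]. *)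
transitivity (\sum_(r < g) \sum_(s <- S) (s == r%:Z)%:R : R).
  apply: eq_bigr => r _; case: (boolP (r%:Z \in S)) => rS.
    rewrite (big_fsetD1 r%:Z)//= eqxx big_seq big1 ?addr0// => s.
    by rewrite in_fsetD1 => /andP[/negPf ->].
  by rewrite big_seq big1// => s sS; case: eqP => // sr; move: rS; rewrite -sr sS.
rewrite exchange_big/= -sum1_size natr_sum !big_seq; apply: eq_bigr => s.
case/imfsetP => h /= hH ->; have gN0 : g%:Z != 0 by rewrite eqz_nat -lt0n.
have : (h %% g)%Z < g by rewrite ltz_pmod.
have : 0 <= (h %% g)%Z by rewrite modz_ge0.
case: (h %% g)%Z => // k _; rewrite ltz_nat => kg.
rewrite (bigD1 (Ordinal kg))//= eqxx big1 ?addr0// => r.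
by rewrite -val_eqE eqz_nat eq_sym /= => /negPf ->.
Qed.

Definition sieve_modulus (G : set nat) (z : nat) :=
  (\prod_(0 <= g < z | g \in G) g)%N.

Lemma sieve_modulus_gt0 G z : positive_elements G -> (0 < sieve_modulus G z)%N.
Proof. by move=> Gpos; apply: prodn_cond_gt0 => g; rewrite inE; exact: Gpos. Qed.

Lemma sifted_mod (G : set nat) (H : {fset int}) z m x :
  (sieve_modulus G z %| m)%N -> sifted G H z (x %% m)%N = sifted G H z x.
Proof.
move=> zm; have E h g : G g -> (g < z)%N ->
    ((x %% m)%N%:Z = h %[mod g%:Z])%Z = (x%:Z = h %[mod g%:Z])%Z.
  move=> Gg gz; have gm : (g %| m)%N.
    apply: dvdn_trans zm; rewrite /sieve_modulus (big_rem g)/=.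
      by rewrite mem_set// dvdn_mulr.
    by rewrite mem_index_iota.
  by rewrite !modz_nat modn_dvdm.
apply/propext; split => sx h g hH Gg gz; first by rewrite -E//; exact: sx.
by rewrite E//; exact: sx.
Qed.

(** Induction on the level. When [z] is in [G] it is coprime to the previous modulus, and the new
    indicator is a function of [r] modulo that modulus times a function of [r] modulo [z]; [sum_crt]
    then splits off the factor of [z]. Otherwise neither the set nor the modulus changes. *)
Lemma sifted_density (R : realType) (G : set nat) (H : {fset int}) z :
  positive_elements G -> pairwise_coprime G ->
  (\sum_(r < sieve_modulus G z) \1_(sifted G H z) (r : nat)) /
    (sieve_modulus G z)%:R =
  \prod_(0 <= g < z | g \in G) (1 - (nu g H)%:R / g%:R) :> R.
Proof.
move=> Gpos Gcop; elim: z => [|z IHz].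
  rewrite /sieve_modulus !big_geq// big_ord1 divr1 indicE mem_set//.
rewrite [RHS]big_mkcond [RHS]big_nat_recr//= -big_mkcond/= -IHz.
have MS : sieve_modulus G z.+1 =
    (sieve_modulus G z * (if z \in G then z else 1))%N.
  by rewrite /sieve_modulus big_mkcond big_nat_recr//= -big_mkcond.
case: (boolP (z \in G)) MS => [zG|zG] MS.
  have z0 : (0 < z)%N by apply: Gpos; move: zG; rewrite inE.
  have M0 := sieve_modulus_gt0 G z Gpos.
  have cop : coprime (sieve_modulus G z) z.
    rewrite /sieve_modulus big_seq_cond; apply: (big_ind (coprime^~ z)) => [|a b az bz|g /andP[]].
    - exact: coprime1n.
    - by rewrite coprimeMl az.
    rewrite mem_index_iota => /= gz gG; apply: Gcop.
    - by move: gG; rewrite inE.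
    - by move: zG; rewrite inE.
    - by rewrite ltn_eqF.
  pose q := [set x : nat | forall h, h \in H -> ~ (x%:Z = h %[mod z%:Z])%Z].
  have E r : \1_(sifted G H z.+1) r =
      \1_(sifted G H z) (r %% sieve_modulus G z)%N * \1_q (r %% z)%N :> R.
    rewrite !indicE -natrM mulnb; congr (_%:R); congr nat_of_bool.
    apply/idP/andP; rewrite !inE sifted_mod//.
      move=> sr; split => [h g hH Gg gz|h hH]; first by apply: sr => //; rewrite ltnW.
      by rewrite -modz_nat modz_mod; apply: sr => //; move: zG; rewrite inE.
    move=> [sr qr] h g hH Gg; rewrite ltnS leq_eqVlt => /predU1P[->|]; last exact: sr.
    by have := qr _ hH; rewrite -modz_nat modz_mod.
  rewrite MS (eq_bigr _ (fun (r : 'I__) _ => E r)) (sum_crt R _ _ _ _ M0 z0 cop).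
  rewrite count_sifted_residues// natrM; field.
  by rewrite !pnatr_eq0 -!lt0n z0.
rewrite MS muln1 mulr1; congr (_ / _); apply: eq_bigr => r _.
congr (\1_ _ _); apply/seteqP; split => x sx h g hH Gg gz.
  by apply: sx => //; exact: ltnW.
move: gz; rewrite ltnS leq_eqVlt => /predU1P[gz|]; last exact: sx.
by move: zG; rewrite -gz mem_set.
Qed.

(** As [density] is a [limn], the existence of the limit has to be proved: by admissibility the
    factors lie between 0 and 1, so the partial products are nonincreasing and nonnegative. *)
Lemma sieve_product_cvg (R : realType) (G : set nat) (H : {fset int}) :
  admissible G H ->
  \prod_(0 <= g < z | g \in G) (1 - (nu g H)%:R / g%:R) @[z --> \oo] -->
    density R G H.
Proof.
move=> adm; have fac g : G g -> 0 <= 1 - ((nu g H)%:R / g%:R : R) <= 1.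
  move=> Gg; have nug := adm _ Gg; have g0 : (0 < g)%N by exact: leq_ltn_trans nug.
  by rewrite subr_ge0 ler_pdivrMr ?ltr0n// mul1r ler_nat ltnW//= gerBl divr_ge0.
pose u z : R := \prod_(0 <= g < z | g \in G) (1 - (nu g H)%:R / g%:R).
have u0 z : 0 <= u z by apply: prodr_ge0 => g gG; have /andP[] := fac g (set_mem gG).
suff : cvgn u by [].
apply: nonincreasing_is_cvgn; last by exists 0 => _ [z _ <-]; exact: u0.
apply/nonincreasing_seqP => z; rewrite /u big_mkcond big_nat_recr//= -big_mkcond/=.
rewrite ler_piMr//; first exact: u0.
by case: ifP => // zG; have /andP[] := fac z (set_mem zG).
Qed.

(** * Equidistribution of a random sequence of permutations on a finite set *)

Lemma cvg_sumr (R : realType) (I : finType) (u : I -> nat -> R) (l : I -> R) :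
  (forall i, u i n @[n --> \oo] --> l i) ->
  \sum_i u i n @[n --> \oo] --> \sum_i l i.
Proof. by move=> ul; apply: cvg_big => //; exact: add_continuous. Qed.

Lemma cvg0_sqr (R : realType) (u : nat -> R) :
  u n ^+ 2 @[n --> \oo] --> 0 -> u n @[n --> \oo] --> 0.
Proof.
move=> /cvgr0Pnorm_lt u2; apply/cvgr0Pnorm_lt => e e0.
have := u2 _ (exprn_gt0 2 e0); apply: filterS => n.
by rewrite normrX ltr_pXn2r ?nnegrE ?normr_ge0 ?(ltW e0).
Qed.

Lemma cvg_bounded_div (R : realType) (u : nat -> R) (C : R) :
  (forall n, `|u n| <= C) -> u n / n%:R @[n --> \oo] --> 0.
Proof.
move=> uC; have C0 : 0 <= C by exact: le_trans (uC 0%N).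
apply/cvgr0Pnorm_le => e e0.
near=> n; have n0 : (0 : R) < n%:R by rewrite ltr0n; near: n; exact: nbhs_infty_gt.
rewrite normrM normfV (gtr0_norm n0) ler_pdivrMr// (le_trans (uC n))//.
rewrite mulrC -ler_pdivrMr//; near: n; exact: nbhs_infty_ger.
Unshelve. all: by end_near. Qed.

Lemma sum_indicator_shift (R : comPzRingType) (T : eqType) (t : nat -> T) x n :
  \sum_(i < n) (t i.+1 == x)%:R =
  \sum_(i < n) (t i == x)%:R + ((t n == x)%:R - (t 0%N == x)%:R) :> R.
Proof.
elim: n => [|n IHn]; first by rewrite !big_ord0 subrr addr0.
by rewrite !big_ord_recr/= IHn; ring.
Qed.

(* With [a] the empirical measure and [P] the transition operator, the
   Dirichlet form of the uniform measure gives
   [2 <a, a - a P> = alpha |a - a s1|^2 + (1 - alpha) |a - a s2|^2],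
   and [a - a P] tends to [0] because its fluctuation part is the one that is
   assumed to be negligible. *)
Lemma empirical_measure_uniform (R : realType) (T : finType) (s1 s2 : T -> T)
    (alpha : R) (flip : nat -> bool) (t : nat -> T) :
  injective s1 -> injective s2 ->
  (forall x y, exists k l, y = iter k s1 (iter l s2 x)) ->
  0 < alpha < 1 ->
  (forall i, t i.+1 = if flip i then s1 (t i) else s2 (t i)) ->
  (forall x, (\sum_(i < n) ((s1 (t i) == x)%:R - (s2 (t i) == x)%:R) *
     ((flip i)%:R - alpha)) / n%:R @[n --> \oo] --> (0 : R)) ->
  forall x, (\sum_(i < n) (t i == x)%:R) / n%:R @[n --> \oo] -->
    (#|T|%:R^-1 : R).
Proof.
move=> inj1 inj2 trans /andP[a0 a1] step LLN.
pose a n x : R := (\sum_(i < n) (t i == x)%:R) / n%:R.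
pose r n x : R := a n x - alpha * ((\sum_(i < n) (s1 (t i) == x)%:R) / n%:R)
  - (1 - alpha) * ((\sum_(i < n) (s2 (t i) == x)%:R) / n%:R).
(* Shifting the time by one changes the visit counts by two end terms only; writing [flip i] as
   [alpha] plus its fluctuation isolates the sum controlled by the hypothesis. *)
have rE n x : r n x = ((t 0%N == x)%:R - (t n == x)%:R) / n%:R +
    (\sum_(i < n) ((s1 (t i) == x)%:R - (s2 (t i) == x)%:R) *
     ((flip i)%:R - alpha)) / n%:R.
  rewrite /r /a -mulrDl !mulrA -!mulrBl; congr (_ / _).
  have := sum_indicator_shift R _ t x n.
  have -> : \sum_(i < n) (t i.+1 == x)%:R = \sum_(i < n)
     (((s1 (t i) == x)%:R - (s2 (t i) == x)%:R) * ((flip i)%:R - alpha) +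
     (alpha * (s1 (t i) == x)%:R + (1 - alpha) * (s2 (t i) == x)%:R)) :> R.
    by apply: eq_bigr => i _; rewrite step; case: (flip i) => /=; ring.
  rewrite !big_split/= -!mulr_sumr => E; lra.
have r0 x : r n x @[n --> \oo] --> 0.
  rewrite (_ : (fun n => r n x) = (fun n => ((t 0%N == x)%:R - (t n == x)%:R) / n%:R +
    (\sum_(i < n) ((s1 (t i) == x)%:R - (s2 (t i) == x)%:R) *
     ((flip i)%:R - alpha)) / n%:R)); last by apply/funext => n; exact: rE.
  rewrite -[X in _ --> X](addr0 0); apply: cvgD; last exact: LLN.
  apply: (@cvg_bounded_div _ (fun n => (t 0%N == x)%:R - (t n == x)%:R) 1) => n.
  by case: (_ == _); case: (_ == _);
    rewrite ?subrr ?subr0 ?sub0r ?normrN ?normr0 ?normr1.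
have a_ge0 n x : 0 <= a n x by rewrite divr_ge0// sumr_ge0// => i _; case: eqP.
have a_le1 n x : a n x <= 1.
  case: n => [|n]; first by rewrite /a big_ord0 mul0r.
  rewrite ler_pdivrMr ?ltr0Sn// mul1r -[leRHS]mulr1 -[X in X%:R * _]card_ord.
  rewrite mulr_natl -sumr_const ler_sum// => i _; by case: eqP.
have reind (s : T -> T) n : injective s -> \sum_x a n x *
    ((\sum_(i < n) (s (t i) == x)%:R) / n%:R) = \sum_x a n (s x) * a n x.
  move=> injs; rewrite (reindex_inj injs)/=; apply: eq_bigr => x _.
  by congr (_ * (_ / _)); apply: eq_bigr => i _; rewrite (inj_eq injs).
pose energy n : R := alpha * (\sum_x (a n x - a n (s1 x)) ^+ 2) +
  (1 - alpha) * \sum_x (a n x - a n (s2 x)) ^+ 2.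
(* An injective [s] permutes the finite type [T], so both sums of squares in the expansion are
   equal. *)
have expand (s : T -> T) n : injective s -> \sum_x (a n x - a n (s x)) ^+ 2 =
    2 * (\sum_x a n x ^+ 2 - \sum_x a n (s x) * a n x).
  move=> injs; have E : \sum_x a n x ^+ 2 = \sum_x a n (s x) ^+ 2.
    exact: (reindex_inj injs).
  under eq_bigr do rewrite sqrrB; rewrite big_split/= sumrB -E.
  rewrite sumrMnl; under [in X in _ - X *+ 2]eq_bigr do rewrite mulrC.
  by rewrite mulrBr mulr_natl mulr_natl mulr2n addrAC.
have energyE n : energy n = 2 * \sum_x a n x * r n x.
  have -> : \sum_x a n x * r n x = \sum_x a n x ^+ 2 -
      alpha * (\sum_x a n (s1 x) * a n x) -
      (1 - alpha) * \sum_x a n (s2 x) * a n x.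
    rewrite -(reind s1)// -(reind s2)// !mulr_sumr -!sumrB; apply: eq_bigr => x _.
    by rewrite /r !mulrBr expr2 !(mulrCA (a n x)).
  rewrite /energy (expand s1)// (expand s2)//.
  move: (\sum_x _) (\sum_x _ * _) (\sum_x _ * _) => A B C; ring.
have energy0 : energy n @[n --> \oo] --> 0.
  apply/norm_cvg0P.
  apply: (@squeeze_cvgr _ _ _ _ (cst 0) (fun n => 2 * \sum_x `|r n x|)).
  - apply: nearW => n; rewrite normr_ge0/= energyE normrM ger0_norm//.
    rewrite ler_pM2l// (le_trans (ler_norm_sum _ _ _))// ler_sum// => x _.
    by rewrite normrM (ger0_norm (a_ge0 _ _)) ler_piMl.
  - exact: cvg_cst.
  - rewrite -[X in _ --> X](mulr0 2); apply: cvgMl_tmp.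
    have := @cvg_sumr _ _ (fun x n => `|r n x|) (fun=> 0).
    by rewrite big1//; apply=> x; exact/norm_cvg0P/r0.
have diff (s : T -> T) (b : R) : 0 < b ->
    (forall n, b * (\sum_x (a n x - a n (s x)) ^+ 2) <= energy n) ->
    forall x, a n (s x) - a n x @[n --> \oo] --> 0.
  move=> b0 bE x; apply: cvg0_sqr.
  apply: (@squeeze_cvgr _ _ _ _ (cst 0) (fun n => b^-1 * energy n)).
  - apply: nearW => n; rewrite sqr_ge0/= mulrC ler_pdivlMr// mulrC.
    apply: le_trans (bE n); rewrite ler_pM2l// -sqrrN opprB.
    by rewrite (bigD1 x)//= lerDl sumr_ge0// => y _; exact: sqr_ge0.
  - exact: cvg_cst.
  - by rewrite -[X in _ --> X](mulr0 b^-1); apply: cvgMl_tmp.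
have sq_ge0 (s : T -> T) n : 0 <= \sum_x (a n x - a n (s x)) ^+ 2.
  by rewrite sumr_ge0// => x _; exact: sqr_ge0.
have b0 : 0 < 1 - alpha by rewrite subr_gt0.
have diff1 := diff s1 alpha a0 _; have diff2 := diff s2 (1 - alpha) b0 _.
have {}diff1 x : a n (s1 x) - a n x @[n --> \oo] --> 0.
  by apply: diff1 => n; rewrite lerDl mulr_ge0 ?sq_ge0 ?ltW.
have {}diff2 x : a n (s2 x) - a n x @[n --> \oo] --> 0.
  by apply: diff2 => n; rewrite lerDr mulr_ge0 ?sq_ge0 ?ltW.
have telesc (s : T -> T) : (forall x, a n (s x) - a n x @[n --> \oo] --> 0) ->
    forall k x, a n (iter k s x) - a n x @[n --> \oo] --> 0.
  move=> ds; elim=> [|k IHk] x /=.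
    by under eq_cvg do rewrite subrr; exact: cvg_cst.
  rewrite (_ : (fun n => _) = (fun n => (a n (s (iter k s x)) - a n (iter k s x)) +
     (a n (iter k s x) - a n x))); last by apply/funext => n; rewrite addrA subrK.
  by rewrite -[X in _ --> X](addr0 0); apply: cvgD; [exact: ds|exact: IHk].
have all_diff x y : a n y - a n x @[n --> \oo] --> 0.
  have [k [l ->]] := trans x y.
  rewrite (_ : (fun n => _) = (fun n =>
    (a n (iter k s1 (iter l s2 x)) - a n (iter l s2 x)) +
    (a n (iter l s2 x) - a n x))); last by apply/funext => n; rewrite addrA subrK.
  by rewrite -[X in _ --> X](addr0 0); apply: cvgD; exact: telesc.
move=> x; have T0 : (0 : R) < #|T|%:R by rewrite ltr0n; apply/card_gt0P; exists x.
(* For [n > 0] the total mass is 1, so [a n x] is [1 / #|T|] minus the mean of these differences. *)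
have avg : \sum_y (a n y - a n x) @[n --> \oo] --> 0.
  have := @cvg_sumr _ _ (fun y n => a n y - a n x) (fun=> 0).
  by rewrite big1//; apply=> y; exact: all_diff.
have : (#|T|%:R^-1 : R) - #|T|%:R^-1 * \sum_y (a n y - a n x) @[n --> \oo] --> (#|T|%:R^-1 : R).
  rewrite -[X in _ --> X]subr0 -[X in _ --> _ - X](mulr0 #|T|%:R^-1).
  by apply: cvgB; [exact: cvg_cst|apply: cvgMl_tmp; exact: avg].
apply: cvg_trans; apply: near_eq_cvg; near=> n.
have n0 : n%:R != 0 :> R by rewrite pnatr_eq0 -lt0n; near: n; exact: nbhs_infty_gt.
have tot : \sum_y a n y = 1.
  rewrite /a -mulr_suml exchange_big/= (eq_bigr (fun=> 1)).
    by rewrite sumr_const card_ord divff.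
  move=> i _; rewrite (bigD1 (t i))//= eqxx big1 ?addr0// => y.
  by rewrite eq_sym => /negPf ->.
rewrite sumrB tot sumr_const -mulr_natl -/(a n x); field.
by rewrite lt0r_neq0.
Unshelve. all: by end_near. Qed.

(** * Deterministic study of a flip sequence that obeys laws of large numbers *)

Definition heads (flip : nat -> bool) (n : nat) : nat := (\sum_(i < n) flip i)%N.

Definition tails (flip : nat -> bool) : nat -> nat := heads (fun i => ~~ flip i).

(** The weight of flip [i] is predictable: it depends on the position reached before that flip. *)
Definition flips_lln (R : realType) (alpha : R) (flip : nat -> bool)
    (f : nat -> nat -> R) : Prop :=
  (\sum_(i < n) f (heads flip i) (tails flip i) * ((flip i)%:R - alpha)) / n%:R
    @[n --> \oo] --> 0.

Lemma headsS flip n : heads flip n.+1 = (heads flip n + flip n)%N.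
Proof. by rewrite /heads big_ord_recr. Qed.

Lemma tailsS flip n : tails flip n.+1 = (tails flip n + ~~ flip n)%N.
Proof. exact: headsS. Qed.

Lemma heads_le flip n : (heads flip n <= n)%N.
Proof.
elim: n => [|n IHn]; first by rewrite /heads big_ord0.
by rewrite headsS -addn1 leq_add//; case: (flip n).
Qed.

(* While [heads] sits at [x], the trials end at the first success, so each
   [x] in [B] contributes at most one success to [sum 1_B (heads i) (flip i)],
   and this sum is close to [alpha * sum 1_B (heads i)]. *)
Lemma visits_sparse (R : realType) (alpha e : R) (flip : nat -> bool)
    (B : set nat) :
  0 < alpha -> 0 < e ->
  (\sum_(i < n) \1_B (heads flip i) * ((flip i)%:R - alpha)) / n%:R
    @[n --> \oo] --> (0 : R) ->
  (\forall n \near \oo, \sum_(0 <= x < n) \1_B x <= e * n%:R :> R) ->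
  \forall n \near \oo,
    (\sum_(i < n) \1_B (heads flip i)) / n%:R <= 2 * e / alpha :> R.
Proof.
move=> a0 e0 /cvgr0Pnorm_le/(_ _ e0) lln sparse; near=> n.
have n0 : (0 : R) < n%:R by rewrite ltr0n; near: n; exact: nbhs_infty_gt.
have succ m : \sum_(i < m) \1_B (heads flip i) * (flip i)%:R =
    \sum_(0 <= x < heads flip m) \1_B x :> R.
  elim: m => [|m IHm]; first by rewrite /heads !big_ord0 big_geq.
  rewrite big_ord_recr/= IHm headsS; case: (flip m) => /=.
    by rewrite mulr1 addn1 big_nat_recr.
  by rewrite mulr0 addr0 addn0.
have : \sum_(i < n) \1_B (heads flip i) * (flip i)%:R <= e * n%:R :> R.
  rewrite succ (@le_trans _ _ (\sum_(0 <= x < n) \1_B x))//; last by near: n.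
  by rewrite [leRHS](@big_cat_nat _ _ _ (heads flip n))//= ?heads_le// lerDl sumr_ge0.
have : `|(\sum_(i < n) \1_B (heads flip i) * ((flip i)%:R - alpha)) / n%:R| <= e.
  by near: n.
rewrite normrM normfV (gtr0_norm n0) ler_pdivrMr// ler_norml => /andP[+ _].
under eq_bigr do rewrite mulrBr.
rewrite sumrB -mulr_suml => lo up.
rewrite ler_pdivrMr// mulrAC ler_pdivlMr//; lra.
Unshelve. all: by end_near. Qed.

(** Exchanging the two outcomes replaces [alpha] by [1 - alpha] and changes the sign of the
    fluctuation; this lets [visits_sparse] serve for the ordinates too. *)
Lemma tails_lln (R : realType) (alpha : R) (flip : nat -> bool) (g : nat -> R) :
  flips_lln R alpha flip (fun _ y => g y) ->
  (\sum_(i < n) g (heads (fun j => ~~ flip j) i) * ((~~ flip i)%:R - (1 - alpha)))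
    / n%:R @[n --> \oo] --> 0.
Proof.
move=> lln; rewrite -[X in _ --> X]oppr0; have E n : (\sum_(i < n) g (heads (fun j => ~~ flip j) i) *
      ((~~ flip i)%:R - (1 - alpha))) / n%:R =
    - ((\sum_(i < n) g (tails flip i) * ((flip i)%:R - alpha)) / n%:R).
  rewrite -mulNr -sumrN; congr (_ / _); apply: eq_bigr => i _.
  by rewrite /tails; case: (flip i) => /=; ring.
apply: cvg_trans (cvgN lln); apply: near_eq_cvg; by apply: nearW => n /=; rewrite E.
Qed.

(** The residues move on the torus ['I_m1 * 'I_m2] by two cyclic shifts, which together reach every
    point. The weights in [empirical_measure_uniform] become indicators of residue classes once the
    shifts are undone by [ord_pred]. *)
Lemma residues_equidistributed (R : realType) (alpha : R) (flip : nat -> bool)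
    (m1 m2 : nat) (r : 'I_m1) (s : 'I_m2) : 0 < alpha < 1 ->
  (forall r s, flips_lln R alpha flip
     (fun x y => ((x %% m1 == r) && (y %% m2 == s))%N%:R)) ->
  (\sum_(i < n) ((heads flip i %% m1 == r) && (tails flip i %% m2 == s))%N%:R)
    / n%:R @[n --> \oo] --> ((m1%:R * m2%:R)^-1 : R).
Proof.
move=> alpha01 lln; have m1_gt0 : (0 < m1)%N by exact: leq_ltn_trans (ltn_ord r).
have m2_gt0 : (0 < m2)%N by exact: leq_ltn_trans (ltn_ord s).
pose t i := (Ordinal (ltn_pmod (heads flip i) m1_gt0),
             Ordinal (ltn_pmod (tails flip i) m2_gt0)).
pose s1 (u : 'I_m1 * 'I_m2) := (ordS u.1, u.2).
pose s2 (u : 'I_m1 * 'I_m2) := (u.1, ordS u.2).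
have tE i a b : (t i == (a, b)) = (heads flip i %% m1 == a)%N && (tails flip i %% m2 == b)%N.
  by rewrite -pair_eqE /= -!val_eqE.
have iter_ordS m k (a : 'I_m) : val (iter k (@ordS m) a) = ((a + k) %% m)%N.
  elim: k => [|k IHk]; first by rewrite addn0 modn_small.
  by rewrite iterS /= IHk -addn1 modnDml addn1 addnS.
have iter_s1 k u : iter k s1 u = (iter k (@ordS m1) u.1, u.2).
  by elim: k => [|k IHk]; [case: u|rewrite iterS IHk].
have iter_s2 k u : iter k s2 u = (u.1, iter k (@ordS m2) u.2).
  by elim: k => [|k IHk]; [case: u|rewrite iterS IHk].
have reach m (a b : 'I_m) : exists k, b = iter k (@ordS m) a.
  (* [m - a] shifts lead from [a] around to 0, and [b] more lead to [b]. *)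
  exists (b + (m - a))%N; apply/val_inj; rewrite /= iter_ordS addnCA.
  by rewrite subnKC ?modnDr ?modn_small// ltnW.
under eq_cvg do under eq_bigr do rewrite -tE.
have -> : m1%:R * m2%:R = #|{: 'I_m1 * 'I_m2}|%:R :> R.
  by rewrite card_prod !card_ord natrM.
apply: (@empirical_measure_uniform _ _ s1 s2 alpha flip) => //.
- move=> [a b] [a' b'] /eqP; rewrite -pair_eqE /=.
  by move=> /andP[/eqP/ordS_inj -> /eqP ->].
- move=> [a b] [a' b'] /eqP; rewrite -pair_eqE /=.
  by move=> /andP[/eqP -> /eqP/ordS_inj ->].
- move=> [a b] [a' b']; have [k ->] := reach _ a a'; have [l ->] := reach _ b b'.
  by exists k, l; rewrite iter_s2 iter_s1.
- move=> i; rewrite /t /s1 /s2 headsS tailsS; case: (flip i) => /=;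
    congr (_, _); apply/val_inj => /=; rewrite ?addn0 ?addn1//.
    by rewrite -[in RHS]addn1 modnDml addn1.
  by rewrite -[in RHS]addn1 modnDml addn1.
move=> [a b]; rewrite -[X in _ --> X]subr0.
have e1 i : (s1 (t i) == (a, b)) = (t i == (ord_pred a, b)).
  by rewrite -!pair_eqE /= (can2_eq (@ordSK _) (@ord_predK _)).
have e2 i : (s2 (t i) == (a, b)) = (t i == (a, ord_pred b)).
  by rewrite -!pair_eqE /= (can2_eq (@ordSK _) (@ord_predK _)).
pose f (x y : nat) n : R := (\sum_(i < n)
  ((heads flip i %% m1 == x) && (tails flip i %% m2 == y))%N%:R *
  ((flip i)%:R - alpha)) / n%:R.
have E n : (\sum_(i < n) ((s1 (t i) == (a, b))%:R - (s2 (t i) == (a, b))%:R) *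
    ((flip i)%:R - alpha)) / n%:R = f (ord_pred a) b n - f a (ord_pred b) n.
  rewrite -mulrBl -sumrB; congr (_ / _); apply: eq_bigr => i _.
  by rewrite e1 e2 !tE mulrBl.
under eq_cvg do rewrite E.
by apply: cvgB; exact: lln.
Qed.

Lemma indic_mod (R : pzRingType) (A : set nat) (m x : nat) :
  (forall x, A (x %% m)%N = A x) -> \1_A (x %% m)%N = \1_A x :> R.
Proof.
by move=> per; rewrite !indicE (_ : (_ \in A) = (x \in A))//;
  apply/idP/idP; rewrite !inE per.
Qed.

(** For fixed [z] the visits to the periodic sets equidistribute. Replacing [V1] and [V2] by them
    costs at most the visits to [B1 z] and [B2 z], since the indicators agree when neither
    coordinate is exceptional. The level [z] is fixed before [n] grows. *)
Lemma sieved_visits_cvg (R : realType) (alpha c1 c2 : R) (flip : nat -> bool)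
    (V1 V2 : set nat) (A1 A2 B1 B2 : nat -> set nat) (M1 M2 : nat -> nat) :
  0 < alpha < 1 ->
  (forall m1 m2 r s, flips_lln R alpha flip
     (fun x y => ((x %% m1 == r) && (y %% m2 == s))%N%:R)) ->
  (forall z, flips_lln R alpha flip (fun x _ => \1_(B1 z) x)) ->
  (forall z, flips_lln R alpha flip (fun _ y => \1_(B2 z) y)) ->
  (forall z, (0 < M1 z)%N) -> (forall z, (0 < M2 z)%N) ->
  (forall z x, A1 z (x %% M1 z)%N = A1 z x) ->
  (forall z x, A2 z (x %% M2 z)%N = A2 z x) ->
  (\sum_(r < M1 z) \1_(A1 z) (r : nat)) / (M1 z)%:R @[z --> \oo] --> c1 ->
  (\sum_(r < M2 z) \1_(A2 z) (r : nat)) / (M2 z)%:R @[z --> \oo] --> c2 ->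
  (forall z x, ~ B1 z x -> V1 x <-> A1 z x) ->
  (forall z x, ~ B2 z x -> V2 x <-> A2 z x) ->
  (forall e, 0 < e -> exists z0, forall z, (z0 <= z)%N -> \forall n \near \oo,
    \sum_(0 <= x < n) \1_(B1 z) x <= e * n%:R :> R) ->
  (forall e, 0 < e -> exists z0, forall z, (z0 <= z)%N -> \forall n \near \oo,
    \sum_(0 <= x < n) \1_(B2 z) x <= e * n%:R :> R) ->
  (\sum_(i < n) \1_V1 (heads flip i) * \1_V2 (tails flip i)) / n%:R
    @[n --> \oo] --> c1 * c2.
Proof.
move=> alpha01 lln lln1 lln2 M1_gt0 M2_gt0 per1 per2 d1 d2 VA1 VA2 sp1 sp2.
have /andP[a0 a1] := alpha01; have b0 : 0 < 1 - alpha by rewrite subr_gt0.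
pose u z n : R := (\sum_(i < n) \1_(A1 z) (heads flip i) * \1_(A2 z) (tails flip i)) / n%:R.
have u_cvg z : u z n @[n --> \oo] -->
    (((\sum_(r < M1 z) \1_(A1 z) (r : nat)) / (M1 z)%:R) *
    ((\sum_(r < M2 z) \1_(A2 z) (r : nat)) / (M2 z)%:R) : R).
  (* Sort the times by the pair of residues; periodicity makes the summand constant on each
     class. *)
  have uE n : u z n = \sum_(r < M1 z) \sum_(s < M2 z)
      \1_(A1 z) (r : nat) * \1_(A2 z) (s : nat) * ((\sum_(i < n)
      ((heads flip i %% M1 z == r) && (tails flip i %% M2 z == s))%N%:R) / n%:R).
    under eq_bigr do under eq_bigr do rewrite mulrA.
    under eq_bigr do rewrite -mulr_suml.
    rewrite -mulr_suml; congr (_ / _).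
    under [RHS]eq_bigr do under eq_bigr do rewrite mulr_sumr.
    under [RHS]eq_bigr do rewrite exchange_big/=.
    rewrite [RHS]exchange_big/=; apply: eq_bigr => i _.
    rewrite (bigD1 (Ordinal (ltn_pmod (heads flip i) (M1_gt0 z))))//=.
    rewrite (bigD1 (Ordinal (ltn_pmod (tails flip i) (M2_gt0 z))))//=.
    rewrite !eqxx mulr1.
    rewrite big1 ?addr0; last first.
      by move=> s; rewrite -val_eqE eq_sym /= => /negPf ->; rewrite mulr0.
    rewrite big1 ?addr0; last first.
      move=> r; rewrite -val_eqE eq_sym /= => /negPf r_neq.
      by rewrite big1// => s _; rewrite r_neq mulr0.
    by rewrite !(indic_mod _ _ _ _ (per1 z)) !(indic_mod _ _ _ _ (per2 z)).
  rewrite mulf_div big_distrlr/= mulr_suml.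
  under eq_cvg do rewrite uE.
  apply: cvg_sumr => r; rewrite mulr_suml; apply: cvg_sumr => s.
  have eq_rs := residues_equidistributed R alpha flip _ _ r s alpha01
    (fun r' s' => lln _ _ r' s').
  exact: (cvgMl_tmp eq_rs).
have close z n : `|(\sum_(i < n) \1_V1 (heads flip i) * \1_V2 (tails flip i)) / n%:R - u z n|
    <= (\sum_(i < n) \1_(B1 z) (heads flip i)) / n%:R +
       (\sum_(i < n) \1_(B2 z) (tails flip i)) / n%:R.
  rewrite /u -mulrBl -mulrDl normrM [X in _ * X]ger0_norm// ler_wpM2r//.
  rewrite -sumrB -big_split/=; apply: le_trans (ler_norm_sum _ _ _) _.
  apply: ler_sum => i _; move: (heads flip i) (tails flip i) => x y.
  have dist1 (b c : bool) : `|b%:R - c%:R| <= 1 :> R.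
    by case: b; case: c; rewrite /= ?subrr ?subr0 ?sub0r ?normrN ?normr0 ?normr1.
  rewrite !indicE -!natrM !mulnb; have [xB|xB] := pselect (B1 z x).
    by rewrite (mem_set xB) ler_wpDr ?dist1.
  have [yB|yB] := pselect (B2 z y); first by rewrite (mem_set yB) ler_wpDl ?dist1.
  have -> : (x \in V1) = (x \in A1 z) by apply/idP/idP => /set_mem/(VA1 z x xB) ?; exact/mem_set.
  have -> : (y \in V2) = (y \in A2 z) by apply/idP/idP => /set_mem/(VA2 z y yB) ?; exact/mem_set.
  by rewrite subrr normr0 addr_ge0.
apply/cvgrPdist_le => e e0.
have e40 : 0 < e / 4 by rewrite divr_gt0.
(* [visits_sparse] multiplies this by [2 / alpha], which leaves [e / 4]; four such errors add up to
   [e]. *)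
have [z1 sp1'] := sp1 (e / 8 * alpha) (mulr_gt0 (divr_gt0 e0 (ltr0Sn _ 7)) a0).
have [z2 sp2'] := sp2 (e / 8 * (1 - alpha)) (mulr_gt0 (divr_gt0 e0 (ltr0Sn _ 7)) b0).
have d12 : (\sum_(r < M1 z) \1_(A1 z) (r : nat)) / (M1 z)%:R *
    ((\sum_(r < M2 z) \1_(A2 z) (r : nat)) / (M2 z)%:R) @[z --> \oo] --> c1 * c2.
  by apply: cvgM.
have /cvgrPdist_le/(_ _ e40)[z3 _ dz] := d12.
pose z := maxn z1 (maxn z2 z3).
have zz1 : (z1 <= z)%N by rewrite leq_maxl.
have zz2 : (z2 <= z)%N by rewrite /z maxnCA leq_maxl.
have zz3 : (z3 <= z)%N by rewrite /z maxnA leq_maxr.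
have v1 := visits_sparse _ _ _ _ (B1 z) a0 (mulr_gt0 (divr_gt0 e0 (ltr0Sn _ 7)) a0)
  (lln1 z) (sp1' _ zz1).
have v2 := visits_sparse _ _ _ _ (B2 z) b0 (mulr_gt0 (divr_gt0 e0 (ltr0Sn _ 7)) b0)
  (tails_lln _ _ _ _ (lln2 z)) (sp2' _ zz2).
have /cvgrPdist_le/(_ _ e40) uz := u_cvg z.
have := dz _ zz3; rewrite /= => {}dz.
near=> n.
have : (\sum_(i < n) \1_(B1 z) (heads flip i)) / n%:R <= 2 * (e / 8 * alpha) / alpha.
  by near: n.
have : (\sum_(i < n) \1_(B2 z) (tails flip i)) / n%:R <= 2 * (e / 8 * (1 - alpha)) / (1 - alpha).
  by near: n.
have : `|(\sum_(r < M1 z) \1_(A1 z) (r : nat)) / (M1 z)%:R *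
    ((\sum_(r < M2 z) \1_(A2 z) (r : nat)) / (M2 z)%:R) - u z n| <= e / 4.
  by near: n.
have := close z n.
rewrite !(mulrA 2) !mulfK ?gt_eqF//.
move: dz; rewrite !ler_norml => /andP[? ?] /andP[? ?] /andP[? ?] ? ?.
by apply/andP; split; lra.
Unshelve. all: by end_near. Qed.

(** * Expectations over finitely many coins, integrating out the last coin first *)

Fixpoint coin_mean (R : pzRingType) (p : R) (n : nat) (F : seq bool -> R) : R :=
  if n is m.+1 then
    coin_mean R p m (fun s => p * F (rcons s true) + (1 - p) * F (rcons s false))
  else F [::].

Lemma eq_coin_mean (R : pzRingType) (p : R) n F G : F =1 G ->
  coin_mean R p n F = coin_mean R p n G.
Proof.
by elim: n F G => [|n IHn] F G FG /=; [exact: FG|apply: IHn => s; rewrite !FG].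
Qed.

Lemma coin_meanD (R : comPzRingType) (p : R) n F G :
  coin_mean R p n (fun s => F s + G s) = coin_mean R p n F + coin_mean R p n G.
Proof.
elim: n F G => [//|n IHn] F G /=; rewrite -IHn.
by apply: eq_coin_mean => s; ring.
Qed.

Lemma coin_meanZ (R : comPzRingType) (p c : R) n F :
  coin_mean R p n (fun s => c * F s) = c * coin_mean R p n F.
Proof.
elim: n F => [//|n IHn] F /=; rewrite -IHn.
by apply: eq_coin_mean => s; ring.
Qed.

Lemma coin_mean_cst (R : comPzRingType) (p c : R) n :
  coin_mean R p n (fun=> c) = c.
Proof.
elim: n => [//|n IHn] /=; rewrite -[RHS]IHn.
by apply: eq_coin_mean => s; ring.
Qed.

Lemma le_coin_mean (R : realDomainType) (p : R) n F G : 0 <= p <= 1 ->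
  (forall s, F s <= G s) -> coin_mean R p n F <= coin_mean R p n G.
Proof.
move=> /andP[p0 p1]; elim: n F G => [|n IHn] F G FG /=; first exact: FG.
by apply: IHn => s; rewrite lerD// ler_wpM2l ?subr_ge0 ?FG.
Qed.

(** A martingale transform: the stake on coin [i] is a function of the earlier coins. *)
Definition coin_martingale (R : pzRingType) (p : R) (f : seq bool -> R)
    (s : seq bool) : R :=
  \sum_(i < size s) f (take i s) * ((nth false s i)%:R - p).

Lemma coin_martingale_rcons (R : pzRingType) (p : R) f s b :
  coin_martingale R p f (rcons s b) =
  coin_martingale R p f s + f s * (b%:R - p).
Proof.
rewrite /coin_martingale size_rcons big_ord_recr/= nth_rcons ltnn eqxx.
rewrite -cats1 take_size_cat//; congr (_ + _); apply: eq_bigr => i _.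
by rewrite takel_cat ?nth_cat ?ltn_ord// ltnW.
Qed.

(** The last coin is centred, so the cross term vanishes on averaging over it; what is added is
    [f s ^ 2 * p * (1 - p)], at most 1. *)
Lemma coin_martingale_second_moment (R : realDomainType) (p : R) f n :
  0 <= p <= 1 -> (forall s, `|f s| <= 1) ->
  coin_mean R p n (fun s => coin_martingale R p f s ^+ 2) <= n%:R.
Proof.
move=> p01 f1; elim: n => [|n IHn] /=.
  by rewrite /coin_martingale big_ord0 expr0n.
apply: (@le_trans _ _ (coin_mean R p n
    (fun s => coin_martingale R p f s ^+ 2 + 1))); last first.
  by rewrite coin_meanD coin_mean_cst -natr1 lerD2r.
apply: le_coin_mean => // s; rewrite !coin_martingale_rcons.
move: (coin_martingale _ _ _ _) => M.
have : f s ^+ 2 <= 1 by rewrite -real_normK ?num_real// expr_le1.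
have := sqr_ge0 (f s); move: (f s) => x x0 x1.
have -> : p * (M + x * (true%:R - p)) ^+ 2 + (1 - p) * (M + x * (false%:R - p)) ^+ 2 =
  M ^+ 2 + x ^+ 2 * (p * (1 - p)) by rewrite /=; ring.
rewrite lerD2l mulr_ile1//; nra.
Qed.

(** * Law of the coin prefixes and the strong law of large numbers *)

Definition coin_prefix (Omega : Type) (D : nat -> Omega -> bool) n w :=
  mkseq (fun i => D i w) n.

Lemma coin_prefixS (Omega : Type) (D : nat -> Omega -> bool) n w :
  coin_prefix Omega D n.+1 w = rcons (coin_prefix Omega D n w) (D n w).
Proof. by rewrite /coin_prefix mkseqS. Qed.

Lemma measurable_coin_prefix d (Omega : measurableType d)
    (D : nat -> Omega -> bool) n :
  (forall i, discrete_RV (D i)) -> discrete_RV (coin_prefix Omega D n).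
Proof.
move=> mD; elim: n => [|n IHn] A.
  have [An|An] := pselect (A [::]).
  - by rewrite (_ : _ @^-1` _ = setT)//; apply/seteqP; split.
  - by rewrite (_ : _ @^-1` _ = set0)//; apply/seteqP; split.
rewrite (_ : _ @^-1` _ =
    (coin_prefix Omega D n @^-1` [set s | A (rcons s true)] `&` D n @^-1` [set true])
  `|` (coin_prefix Omega D n @^-1` [set s | A (rcons s false)] `&` D n @^-1` [set false])).
  by apply: measurableU; apply: measurableI; first [exact: IHn|exact: mD].
apply/seteqP; split => w /=; rewrite coin_prefixS.
- by case: (D n w) => ?; [left|right].
- by move=> [] [? ->].
Qed.

(** Carries probabilities of prefix events over to [coin_mean], where they are bounded by finite
    computations instead of integrals over [Omega]. *)
Lemma coin_prefix_law d (Omega : measurableType d) (R : realType)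
    (P : probability Omega R) (D : nat -> Omega -> bool) (p : R) :
  (forall i, discrete_RV (D i)) -> mutually_independent P D ->
  (forall i, P (D i @^-1` [set true]) = p%:E) ->
  forall n (A : set (seq bool)),
  P (coin_prefix Omega D n @^-1` A) = (coin_mean R p n \1_A)%:E.
Proof.
move=> mD indep Dp.
have Dq i : P (D i @^-1` [set false]) = (1 - p)%:E.
  rewrite (_ : _ @^-1` _ = ~` (D i @^-1` [set true])).
    by rewrite probability_setC ?Dp//; exact: mD.
  by apply/seteqP; split => w /=; case: (D i w).
(* Fixing the later coins makes the induction go through with independence
   of coordinates only. *)
suff law n A (J : {fset nat}) (B : nat -> set bool) :
    (forall j, j \in J -> (n <= j)%N) ->
    P (coin_prefix Omega D n @^-1` A `&` \bigcap_(j in [set` J]) (D j @^-1` B j))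
    = ((coin_mean R p n \1_A)%:E * \prod_(j <- J) P (D j @^-1` B j))%E.
  move=> n A; have := law n A fset0 (fun=> setT).
  rewrite big_seq_fset0 mule1 => <-//.
  by congr (P _); rewrite [X in _ `&` X](_ : _ = setT) ?setIT// -subTset => w _ j.
elim: n A J B => [|n IHn] A J B nJ.
  rewrite -indep /=; have [An|An] := pselect (A [::]).
  - by rewrite indicE mem_set// mul1e; congr (P _); apply/seteqP; split => // w [].
  - by rewrite indicE memNset// mul0e -(measure0 P); congr (P _);
      apply/seteqP; split => // w [].
have nJ' : n \notin J by apply/negP => /nJ; rewrite ltnn.
have mE : measurable (\bigcap_(j in [set` J]) (D j @^-1` B j)).
  by apply: fin_bigcap_measurable => // j _; exact: mD.
pose C b := coin_prefix Omega D n @^-1` [set s | A (rcons s b)] `&`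
  (D n @^-1` [set b] `&` \bigcap_(j in [set` J]) (D j @^-1` B j)).
have mC b : measurable (C b).
  apply: measurableI; first exact: measurable_coin_prefix.
  by apply: measurableI => //; exact: mD.
have half b : P (C b) =
    ((coin_mean R p n (fun s => \1_A (rcons s b)))%:E * (P (D n @^-1` [set b]) *
    \prod_(j <- J) P (D j @^-1` B j)))%E.
  (* The value of coin [n] joins the constraints on the later coins, so that the induction
     hypothesis applies with [J] enlarged by [n]. *)
  pose B' j := if j == n then [set b] else B j.
  transitivity (P (coin_prefix Omega D n @^-1` [set s | A (rcons s b)] `&`
     \bigcap_(j in [set` (n |` J)%fset]) (D j @^-1` B' j))).
    congr (P (_ `&` _)); apply/seteqP; split => w /=.
    - move=> [Dn DJ] j /=; rewrite /B' in_fset1U; case: eqP => [->//|_ /=].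
      exact: DJ.
    - move=> Dw; split; first by have := Dw n; rewrite /B' /= eqxx; apply; rewrite fset1U1.
      move=> j /= jJ; have := Dw j; rewrite /B' /= in_fset1U jJ orbT.
      case: eqP => [jn|_]; last exact.
      by move: nJ'; rewrite -jn jJ.
  rewrite IHn; last by move=> j; rewrite in_fset1U => /orP[/eqP->//|/nJ/ltnW].
  rewrite big_fsetU1//= /B' eqxx; congr (_ * (_ * _))%E.
  apply: eq_big_seq => // j jJ; case: eqP => // jn.
  by move: nJ'; rewrite -jn jJ.
rewrite (_ : _ `&` _ = C true `|` C false); last first.
  apply/seteqP; split => w /=; rewrite coin_prefixS.
  - by rewrite /C /=; case: (D n w) => -[]; [left|right].
  - by move=> [] [/= ? [/= -> ?]].
have -> : P (C true `|` C false) = (P (C true) + P (C false))%E.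
  apply: measureU => //; apply/seteqP; split => w //=.
  by move=> [[_ [/= Dt _]] [_ [/= Df _]]]; move: Df; rewrite Dt.
have p01 : 0 <= p <= 1.
  by rewrite -!lee_fin -(Dp 0%N) measure_ge0 probability_le1//; exact: mD.
have ge0 b : 0 <= coin_mean R p n (fun s => \1_A (rcons s b)).
  by rewrite -(coin_mean_cst R p 0 n); apply: le_coin_mean.
rewrite !half Dp Dq !muleA -!EFinM -ge0_muleDl ?lee_fin ?mulr_ge0 ?subr_ge0//;
  [|by case/andP: p01..].
by rewrite -EFinD /= coin_meanD !coin_meanZ mulrC [X in _ + X]mulrC.
Qed.

(** From [k.+1 ^ 2] up to an [n] below [k.+2 ^ 2] the sequence moves by at most [2 * k.+1], which is
    at most [(e / 2) * k.+1 ^ 2] as soon as [k.+1 >= 4 / e]. *)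
Lemma cvg_average_squares (R : realType) (u : nat -> R) :
  (forall n, `|u n.+1 - u n| <= 1) ->
  (forall e, 0 < e -> exists k0, forall k, (k0 <= k)%N ->
     `|u (k.+1 ^ 2)%N| <= e * (k.+1 ^ 2)%:R) ->
  u n / n%:R @[n --> \oo] --> 0.
Proof.
move=> u1 usq.
have udiff n m : `|u (n + m)%N - u n| <= m%:R.
  elim: m => [|m IHm]; first by rewrite addn0 subrr normr0.
  rewrite -(subrKA (u (n + m)%N)) (le_trans (ler_normD _ _))//.
  by rewrite -natr1 addrC lerD// addnS.
have root n : exists k, (k ^ 2 <= n < k.+1 ^ 2)%N.
  elim: n => [|n [k /andP[kn nk]]]; first by exists 0%N.
  have [nk'|nk'] := ltnP n.+1 (k.+1 ^ 2)%N.
    by exists k; rewrite nk' (leq_trans kn).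
  exists k.+1; rewrite nk'/= (leq_ltn_trans nk)// ltn_exp2r//.
apply/cvgr0Pnorm_le => e e0; have e20 : 0 < e / 2 by rewrite divr_gt0.
have [k0 usq0] := usq _ e20.
have [m em] : exists m, 4 / e <= m%:R :> R.
  by exists (Num.bound (4 / e)); rewrite ltW// archi_boundP// divr_ge0 ?ltW.
near=> n; have n0 : (0 : R) < n%:R by rewrite ltr0n; near: n; exact: nbhs_infty_gt.
rewrite normrM normfV (gtr0_norm n0) ler_pdivrMr//.
have [[|k] /andP[kn nk]] := root n.
  by move: nk; rewrite exp1n ltnS leqn0 => /eqP nE; move: n0; rewrite nE ltxx.
have Kk : (maxn k0 m <= k)%N.
  have : ((maxn k0 m).+1 ^ 2 < k.+2 ^ 2)%N.
    by apply: leq_ltn_trans nk; near: n; exact: nbhs_infty_ge.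
  by rewrite ltn_exp2r.
have kk0 : (k0 <= k)%N by rewrite (leq_trans _ Kk)// leq_maxl.
have ek : 4 <= e * k.+1%:R.
  rewrite mulrC -ler_pdivrMr// (le_trans em)// ler_nat.
  by rewrite (leq_trans _ (leqnSn k))// (leq_trans _ Kk)// leq_maxr.
have kn' : k.+1%:R ^+ 2 <= n%:R :> R by rewrite -natrX ler_nat.
have nk' : n%:R - k.+1%:R ^+ 2 <= 2 * k.+1%:R :> R.
  rewrite lerBlDr -natrX -natrM -natrD ler_nat -ltnS (leq_trans nk)//.
  by rewrite -(addn1 k.+1) sqrnD exp1n muln1; lia.
have := usq0 _ kk0; have := udiff (k.+1 ^ 2)%N (n - k.+1 ^ 2)%N.
rewrite subnKC// natrB// natrX => dn uk.
rewrite -(subrK (u (k.+1 ^ 2)%N) (u n)) (le_trans (ler_normD _ _))//.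
have k_ge0 : (0 : R) < k.+1%:R by rewrite ltr0Sn.
nra.
Unshelve. all: by end_near. Qed.

(** At time [N] the second moment is at most [N], so Chebyshev bounds the probability of a deviation
    beyond [e * N] by [1 / (e ^ 2 * N)]. This is summable over the squares [N = k.+1 ^ 2];
    Borel-Cantelli applies along them, and bounded increments fill the gaps. *)
Lemma coin_martingale_lln d (Omega : measurableType d) (R : realType)
    (P : probability Omega R) (D : nat -> Omega -> bool) (p : R)
    (f : seq bool -> R) :
  (forall i, discrete_RV (D i)) -> mutually_independent P D ->
  (forall i, P (D i @^-1` [set true]) = p%:E) ->
  (forall s, `|f s| <= 1) ->
  {ae P, forall w,
    coin_martingale R p f (coin_prefix Omega D n w) / n%:R @[n --> \oo] --> 0}.
Proof.
move=> mD indep Dp f1.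
have p01 : 0 <= p <= 1.
  by rewrite -!lee_fin -(Dp 0%N) measure_ge0 probability_le1//; exact: mD.
pose M n w := coin_martingale R p f (coin_prefix Omega D n w).
pose F (e : R) k := [set w | e * (k.+1 ^ 2)%:R < `|M (k.+1 ^ 2)%N w|].
have mF e k : measurable (F e k).
  exact: (measurable_coin_prefix _ _ D (k.+1 ^ 2)%N mD
    [set s | e * (k.+1 ^ 2)%:R < `|coin_martingale R p f s|]).
have PF e k : 0 < e -> (P (F e k) <= (e ^- 2 * k.+1%:R ^- 2)%:E)%E.
  move=> e0; have c0 : 0 < e * (k.+1 ^ 2)%:R by rewrite mulr_gt0// ltr0n expn_gt0.
  pose A := [set s | e * (k.+1 ^ 2)%:R < `|coin_martingale R p f s|].
  rewrite (_ : F e k = coin_prefix Omega D (k.+1 ^ 2)%N @^-1` A)//.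
  rewrite (coin_prefix_law _ _ _ P D p)// lee_fin.
  apply: (@le_trans _ _ (coin_mean R p (k.+1 ^ 2)%N
     (fun s => (e * (k.+1 ^ 2)%:R) ^- 2 * coin_martingale R p f s ^+ 2))).
    apply: le_coin_mean => // s; rewrite indicE; case: (boolP (s \in A)) => sA /=.
      rewrite mulrC ler_pdivlMr ?exprn_gt0// mul1r -[leRHS]real_normK ?num_real//.
      rewrite ler_pXn2r ?nnegrE ?normr_ge0 ?(ltW c0)//.
      by move: sA; rewrite inE => /ltW.
    by rewrite mulr_ge0 ?sqr_ge0// invr_ge0 sqr_ge0.
  rewrite coin_meanZ (le_trans (ler_wpM2l _ (coin_martingale_second_moment _ _ _ _ p01 f1)))//.
    by rewrite invr_ge0 exprn_ge0// ltW.
  rewrite natrX le_eqVlt; apply/orP; left; apply/eqP; field.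
  by rewrite addrC natr1 pnatr_eq0 /= lt0r_neq0.
have F0 e : 0 < e -> P (lim_sup_set (F e)) = 0%E.
  move=> e0; apply: lim_sup_set_cvg0; first exact: mF.
  apply: (@le_lt_trans _ _ (e ^- 2 * 2)%:E); last exact: ltry.
  apply: lime_le; first by apply: is_cvg_nneseries => k _ _; exact: measure_ge0.
  apply: nearW => n.
  apply: (@le_trans _ _ (\sum_(0 <= k < n) (e ^- 2 * k.+1%:R ^- 2)%:E)%E).
    by apply: lee_sum => k _; exact: PF.
  rewrite sumEFin lee_fin -mulr_sumr ler_pM2l ?invr_gt0 ?exprn_gt0//.
  (* A telescoping majorant: [1 / x ^ 2] is at most [2 / x - 2 / (x + 1)] for [x >= 1]. *)
  suff : \sum_(0 <= k < n) (k.+1%:R ^- 2 : R) <= 2 - 2 / n.+1%:R.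
    by move=> /le_trans; apply; rewrite gerDl oppr_le0 divr_ge0.
  elim: n => [|n IHn]; first by rewrite big_nil divr1 subrr.
  rewrite big_nat_recr//= (le_trans (lerD IHn (lexx _)))//.
  have : (1 : R) <= n.+1%:R by rewrite ler1n.
  have -> : n.+2%:R = n.+1%:R + 1 :> R by rewrite -natr1.
  move: (n.+1%:R : R) => x x1; rewrite -subr_ge0.
  have -> : 2 - 2 / (x + 1) - (2 - 2 / x + x ^- 2) = (x - 1) / ((x + 1) * x ^+ 2).
    by field; apply/andP; split; lra.
  by rewrite divr_ge0 ?mulr_ge0 ?exprn_ge0//; lra.
(* The thresholds [1 / m.+1] suffice for all [e > 0] and keep the union of null sets countable. *)
have : {ae P, forall w, forall m, ~ lim_sup_set (F m.+1%:R^-1) w}.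
  apply: ae_foralln => m; exists (lim_sup_set (F m.+1%:R^-1)); split => //.
  - apply: bigcapT_measurable => n; apply: bigcup_measurable => k _; exact: mF.
  - exact: F0.
  - by move=> w /= /contrapT.
apply: filterS => w Fw; apply: cvg_average_squares.
- move=> n; rewrite coin_prefixS coin_martingale_rcons addrAC subrr add0r normrM.
  rewrite mulr_ile1// ler_norml; case/andP: p01 => p0 p1.
  by case: (D n w) => /=; apply/andP; split; lra.
- move=> e e0; have [m me] : exists m, m.+1%:R^-1 <= e.
    exists (Num.bound e^-1); rewrite invf_ple ?posrE// ltW//.
    by rewrite (lt_le_trans (archi_boundP _)) ?invr_ge0 ?(ltW e0)// ler_nat.
  have := Fw m; rewrite /lim_sup_set -existsNP => -[k0 Fk0].
  exists k0 => k k0k; rewrite leNgt; apply/negP => lt_e; apply: Fk0 => _.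
  exists k => //=; apply: le_lt_trans lt_e.
  by rewrite ler_pM2r// ltr0n expn_gt0.
Qed.

Lemma coin_martingale_heads (R : pzRingType) (p : R) (f : nat -> nat -> R)
    (Omega : Type) (D : nat -> Omega -> bool) n w :
  coin_martingale R p (fun s => f (count id s) (count negb s))
    (coin_prefix Omega D n w) =
  \sum_(i < n) f (heads (D ^~ w) i) (tails (D ^~ w) i) * ((D i w)%:R - p).
Proof.
have count_prefix (q : pred bool) m :
    count q (coin_prefix Omega D m w) = (\sum_(i < m) q (D i w))%N.
  elim: m => [|m IHm]; first by rewrite big_ord0.
  by rewrite coin_prefixS -cats1 count_cat IHm big_ord_recr/= addn0.
elim: n => [|n IHn]; first by rewrite /coin_martingale big_ord0 big_ord0.
by rewrite coin_prefixS coin_martingale_rcons IHn big_ord_recr/= !count_prefix.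
Qed.

Lemma flips_lln_ae d (Omega : measurableType d) (R : realType)
    (P : probability Omega R) (D : nat -> Omega -> bool) (p : R)
    (f : nat -> nat -> R) :
  (forall i, discrete_RV (D i)) -> mutually_independent P D ->
  (forall i, P (D i @^-1` [set true]) = p%:E) ->
  (forall x y, `|f x y| <= 1) ->
  {ae P, forall w, flips_lln R p (D ^~ w) f}.
Proof.
move=> mD indep Dp f1.
have := coin_martingale_lln _ _ _ P D p
  (fun s => f (count id s) (count negb s)) mD indep Dp (fun s => f1 _ _).
apply: filterS => w; rewrite /flips_lln.
by under eq_cvg do rewrite coin_martingale_heads.
Qed.

(** * From the random walk to coin flips, and conclusion *)

Lemma measurable_step d (Omega : measurableType d)
    (S : nat -> Omega -> int * int) i :
  (forall i, discrete_RV (S i)) -> discrete_RV (step S i).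
Proof.
move=> mS B; rewrite (_ : _ @^-1` _ = \bigcup_(a : int * int)
    (S i @^-1` [set a] `&` S i.+1 @^-1` [set b | B (b - a)])).
  apply: countable_bigcupT_measurable => [|a]; first exact: countableP.
  by apply: measurableI; exact: mS.
apply/seteqP; split => w /=; first by exists (S i w).
by move=> [a _ [/= <-]].
Qed.

Definition right_step (Omega : Type) (S : nat -> Omega -> int * int) i w : bool :=
  step S i w == (1, 0).

Lemma walk_heads_tails (Omega : Type) (S : nat -> Omega -> int * int) w :
  S 0%N w = (0, 0) ->
  (forall i, step S i w = (1, 0) \/ step S i w = (0, 1)) ->
  forall n, S n w = ((heads (right_step Omega S ^~ w) n)%:Z,
                     (tails (right_step Omega S ^~ w) n)%:Z).
Proof.
move=> S0 steps; elim=> [|n IHn]; first by rewrite S0 /tails /heads !big_ord0.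
rewrite headsS tailsS !PoszD.
have -> : S n.+1 w = step S n w + S n w by rewrite /step subrK.
rewrite IHn /right_step addrC; case: (steps n) => -> /=.
- by apply: injective_projections; rewrite /= ?addr0.
- by apply: injective_projections; rewrite /= ?addr0.
Qed.

(** The two step events are disjoint with probabilities adding up to 1, so every other step has
    probability 0, and there are countably many times. *)
Lemma walk_steps_ae d (Omega : measurableType d) (R : realType)
    (P : probability Omega R) (alpha : R) (S : nat -> Omega -> int * int) :
  random_walk P alpha S ->
  {ae P, forall w i, step S i w = (1, 0) \/ step S i w = (0, 1)}.
Proof.
move=> [_ mS Pr Pu _]; apply: ae_foralln => i.
exists (~` (step S i @^-1` [set (1, 0)] `|` step S i @^-1` [set (0, 1)])).
have mU : measurable (step S i @^-1` [set (1, 0)] `|` step S i @^-1` [set (0, 1)]).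
  by apply: measurableU; exact: measurable_step.
split; first exact: measurableC.
- pose E1 := step S i @^-1` [set (1, 0)]; pose E2 := step S i @^-1` [set (0, 1)].
  have U1 : P (E1 `|` E2) = (P E1 + P E2)%E.
    apply: measureU; [exact: measurable_step|exact: measurable_step|].
    by apply/seteqP; split => w //; rewrite /E1 /E2 => -[/= -> []].
  apply: (etrans (probability_setC _ mU)); rewrite U1 /E1 /E2 Pr Pu.
  by rewrite -EFinD addrCA subrr addr0 subrr.
- by move=> w; apply: contra_not => -[]; [left|right].
Qed.

Theorem theorem1p6 (R : realType) (G1 G2 : set nat) (H1 H2 : {fset int})
    (A0 theta1 theta2 alpha : R)
    (d : measure_display) (Omega : measurableType d) (P : probability Omega R)
    (S : nat -> Omega -> int * int) :
  positive_elements G1 -> positive_elements G2 ->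
  pairwise_coprime G1 -> pairwise_coprime G2 ->
  admissible G1 H1 -> admissible G2 H2 ->
  0 < A0 ->
  0 < theta1 < 1 -> 0 < theta2 < 1 ->
  condition_A (positive_integers R) (truncated_products A0 G1) theta1 ->
  condition_A (positive_integers R) (truncated_products A0 G2) theta2 ->
  0 < alpha < 1 ->
  random_walk P alpha S ->
  {ae P, forall w,
    mean_visits R S (sieved G1 H1 `*` sieved G2 H2) n w @[n --> \oo] -->
      density R G1 H1 * density R G2 H2}.
Proof.
move=> pos1 pos2 cop1 cop2 adm1 adm2 A00 th1 th2 cA1 cA2 alpha01 walk.
have [S0 mS Pr Pu indep] := walk.
have [B1 sum1] := condition_A_sum_inv_bounded _ _ _ _ pos1 A00 th1 cA1.
have [B2 sum2] := condition_A_sum_inv_bounded _ _ _ _ pos2 A00 th2 cA2.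
pose D := right_step Omega S.
(* Events about the coin [D i] are events about step [i], so measurability and independence carry
   over. *)
have DE i (B : set bool) :
  D i @^-1` B = step S i @^-1` [set u | B (u == (1, 0))] by [].
have mD i : discrete_RV (D i) by move=> B; rewrite DE; exact: measurable_step.
have indepD : mutually_independent P D.
  by move=> J B; have := indep J (fun j => [set u | B j (u == (1, 0))]).
have Dp i : P (D i @^-1` [set true]) = alpha%:E.
  rewrite -(Pr i) DE; congr (P (_ @^-1` _)).
  by apply/seteqP; split => u /= => [/eqP|->]; rewrite ?eqxx.
have lln f := flips_lln_ae _ _ _ P D alpha f mD indepD Dp.
have indic1 (A : set nat) x : `|\1_A x| <= 1 :> R.
  by rewrite indicE normr_nat lern1; case: (_ \in _).
(* The moduli, residues and levels are natural numbers, so one null set serves for all the weights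
   used. *)
have lln0 : {ae P, forall w, forall m1 m2 r s, flips_lln R alpha (D ^~ w)
    (fun x y => ((x %% m1 == r) && (y %% m2 == s))%N%:R)}.
  do 4 (apply: ae_foralln => ?); apply: lln => x y.
  by rewrite normr_nat lern1; case: (_ && _).
have lln1 : {ae P, forall w, forall z, flips_lln R alpha (D ^~ w)
    (fun x _ => \1_(late_sieve G1 H1 z) x)}.
  by apply: ae_foralln => z; exact: lln.
have lln2 : {ae P, forall w, forall z, flips_lln R alpha (D ^~ w)
    (fun _ y => \1_(late_sieve G2 H2 z) y)}.
  by apply: ae_foralln => z; exact: lln.
have steps := walk_steps_ae _ _ _ _ _ _ walk.
near=> w.
pose V1 := [set x : nat | sieved G1 H1 x%:Z].
pose V2 := [set x : nat | sieved G2 H2 x%:Z].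
pose v i : R := \1_V1 (heads (D ^~ w) i) * \1_V2 (tails (D ^~ w) i).
have key : (\sum_(i < n) v i) / n%:R @[n --> \oo] --> density R G1 H1 * density R G2 H2.
  apply: (sieved_visits_cvg R alpha _ _ (D ^~ w) V1 V2 (sifted G1 H1) (sifted G2 H2)
    (late_sieve G1 H1) (late_sieve G2 H2) (sieve_modulus G1) (sieve_modulus G2)) => //.
  - by near: w.
  - by near: w.
  - by near: w.
  - by move=> z; exact: sieve_modulus_gt0.
  - by move=> z; exact: sieve_modulus_gt0.
  - by move=> z x; rewrite sifted_mod.
  - by move=> z x; rewrite sifted_mod.
  - under eq_cvg do rewrite sifted_density//; exact: sieve_product_cvg.
  - under eq_cvg do rewrite sifted_density//; exact: sieve_product_cvg.
  - by move=> z x; exact: sieved_sifted.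
  - by move=> z x; exact: sieved_sifted.
  - by move=> e e0; exact: (late_sieve_sparse _ _ _ _ _ pos1 sum1 e0).
  - by move=> e e0; exact: (late_sieve_sparse _ _ _ _ _ pos2 sum2 e0).
(* [mean_visits] runs over the times 1 to [n], the flip sums over 0 to [n - 1]; the bounded
   difference vanishes after division by [n]. *)
have visitsE n : mean_visits R S (sieved G1 H1 `*` sieved G2 H2) n w =
    (\sum_(i < n) v i) / n%:R + (v n - v 0%N) / n%:R.
  rewrite /mean_visits -mulrDl; congr (_ / _).
  have vE i : \1_(sieved G1 H1 `*` sieved G2 H2) (S i w) = v i.
    rewrite /v (walk_heads_tails _ _ _ (S0 w)); last by near: w.
    rewrite !indicE -natrM mulnb; congr (_%:R); congr nat_of_bool.
    by apply/idP/andP; rewrite !inE.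
  rewrite (eq_bigr _ (fun i _ => vE i)) -(big_mkord xpredT v) addrA.
  by rewrite -big_nat_recr//= [X in _ = X - _]big_ltn// addrAC subrr add0r.
have ends : (v n - v 0%N) / n%:R @[n --> \oo] --> (0 : R).
  apply: (cvg_bounded_div _ (fun n => v n - v 0%N) 1) => n.
  rewrite /v !indicE -!natrM !mulnb.
  by case: (_ && _); case: (_ && _);
    rewrite /= ?subrr ?subr0 ?sub0r ?normrN ?normr0 ?normr1.
have total : (\sum_(i < n) v i) / n%:R + (v n - v 0%N) / n%:R @[n --> \oo] -->
    density R G1 H1 * density R G2 H2 + 0.
  by apply: cvgD.
by rewrite addr0 in total; under eq_cvg do rewrite visitsE.
Unshelve. all: by end_near. Qed.
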